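(* Let $\lambda$ and $\beta$ be positive random variables on a probability space $(\Omega,\mathcal F,\mathbb P)$ satisfying $$\mathbb E\left[\frac{\beta}{\lambda^{1/\beta}}\left(\frac{\beta+1}{\beta}\right)^{\frac{\beta+1}{\beta}}\right]<\infty,\qquad \mathbb E[\lambda]<\infty,\qquad \mathbb E[\lambda\beta]<\infty .$$ Then there exists a positive random variable $\tau$ on $(\Omega,\mathcal F,\mathbb P)$ such that $$\lambda=\tau\left(\frac{1}{\mathbb E[e^{-\tau}]}-1\right)^\beta$$ almost surely, and it is unique (up to almost sure equality).
   Context: $\mathbb E$ denotes expectation with respect to $\mathbb P$; for a positive random variable $\tau$ one has $0<\mathbb E[e^{-\tau}]<1$. *)

(* Defs.v *)
From mathcomp Require Export all_boot all_order all_algebra.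
From mathcomp Require Export all_classical all_reals all_analysis.

Set Implicit Arguments.
Unset Strict Implicit.
Unset Printing Implicit Defensive.

Import Order.TTheory GRing.Theory Num.Theory.
Import numFieldNormedType.Exports.

Local Open Scope classical_set_scope.
Local Open Scope ring_scope.

Definition positive_rv d (T : measurableType d) (R : realType)
    (P : probability T R) (X : {RV P >-> R}) : Prop :=
  forall w, 0 < X w.

(* E[exp (- tau)] as a real number. [fine] loses nothing when tau is positive,
   since the expectation then lies in ]0, 1[. *)
Definition laplace1 d (T : measurableType d) (R : realType)
    (P : probability T R) (tau : {RV P >-> R}) : R :=
  fine ('E_P[fun w => (expR (- tau w))%R])%E.

Definition solves_fixed_point d (T : measurableType d) (R : realType)
    (P : probability T R) (lambda beta tau : {RV P >-> R}) : Prop :=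
  {ae P, forall w,
    lambda w = tau w * ((1 / laplace1 tau - 1) `^ beta w)}.

(* Main.v *)
Require Import Defs.
From HB Require Import structures.
From mathcomp Require Import all_boot all_order all_algebra.
From mathcomp Require Import all_classical all_reals all_analysis.
From mathcomp Require Import measurable_realfun.

Set Implicit Arguments.
Unset Strict Implicit.
Unset Printing Implicit Defensive.

Import Order.TTheory GRing.Theory Num.Theory.
Import numFieldNormedType.Exports.

Local Open Scope classical_set_scope.
Local Open Scope ring_scope.

(** Put x = 1 / E[exp (- tau)] - 1, so that tau = lambda x^-beta and the equation
    becomes E[exp (- lambda x^-beta)] = 1 / (1 + x) for the single real x > 0.  By
    bounded convergence the left-hand side is continuous and nondecreasing in x, from
    0 at 0 to 1 at +oo, while the right-hand side decreases strictly from 1 to 0: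
    they agree at exactly one x.  We write x = exp t with t real. *)

Lemma cvgn_mulry (R : realType) (c : R) : 0 < c -> n%:R * c @[n --> \oo] --> +oo.
Proof.
move=> c0; apply: (@cvg_comp _ _ _ (fun n => n%:R) (fun x : R => x * c)).
  exact: cvgr_idn.
by apply: gt0_cvgMly => //; exact: cvg_id.
Qed.

Lemma normr_expRN_le1 (R : realType) (x : R) : 0 < x -> `|expR (- x)| <= 1.
Proof. by move=> x0; rewrite ger0_norm ?expR_ge0// expR_le1 oppr_le0 ltW. Qed.

(** * Integration of bounded functions against a probability measure *)

Section probability_Rintegral.
Context d (T : measurableType d) (R : realType) (P : probability T R).
Implicit Type f : T -> R.

Lemma bounded_integrable_probability f (M : R) :
  measurable_fun setT f -> (forall w, `|f w| <= M) ->
  P.-integrable setT (EFin \o f).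
Proof.
move=> mf fM; apply: measurable_bounded_integrable => //.
  by apply: le_lt_trans (probability_le1 P measurableT) _; exact: ltry.
exists M; split; first by rewrite num_real.
by move=> y My w _; apply: le_trans (fM w) (ltW My).
Qed.

Lemma bounded_cvg_Rintegral (f_ : nat -> T -> R) f (M : R) :
  (forall n, measurable_fun setT (f_ n)) -> measurable_fun setT f ->
  (forall w, f_ n w @[n --> \oo] --> f w) ->
  (forall n w, `|f_ n w| <= M) -> (forall w, `|f w| <= M) ->
  (\int[P]_w f_ n w)%R @[n --> \oo] --> (\int[P]_w f w)%R.
Proof.
move=> mf_ mf f_f f_M fM.
have If := bounded_integrable_probability mf fM.
apply: fine_cvg; rewrite fineK; last exact: integrable_fin_num If.
apply: (@dominated_cvg _ _ _ P setT _ _ _ (EFin \o cst M)) => //.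
- by move=> n; exact/measurable_EFinP.
- by move=> w _; apply: cvg_EFin; [exact: nearW|exact: f_f].
- by apply: (@bounded_integrable_probability (cst M) `|M|) => // w; exact: lexx.
- by move=> n w _; rewrite lee_fin.
Qed.

Lemma Rintegral_cst_probability (c : R) : (\int[P]_w cst c w)%R = c.
Proof. by rewrite Rintegral_cst// -[X in fine X]/(P setT) probability_setT mulr1. Qed.

(** A nonnegative function with zero integral vanishes almost everywhere, hence at some point at
    least, and [f] vanishes nowhere. *)
Lemma Rintegral_gt0 f : measurable_fun setT f -> P.-integrable setT (EFin \o f) ->
  (forall w, 0 < f w) -> 0 < (\int[P]_w f w)%R.
Proof.
move=> mf If f0.
rewrite lt_neqAle Rintegral_ge0 ?andbT; last by move=> w _; exact: ltW.
apply/eqP => /esym If0.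
have : (\int[P]_w `|(EFin \o f) w|)%E = 0%E.
  under eq_integral do rewrite gee0_abs ?lee_fin ?ltW//.
  by rewrite -[LHS]fineK ?[fine _]If0//; exact: integrable_fin_num If.
move/ae_eq_integral_abs => /(_ measurableT).
have mEf : measurable_fun setT (EFin \o f) by exact/measurable_EFinP.
move=> /(_ mEf) ae0.
(* Since [P setT = 1] is not zero, no almost sure event is empty, so a witness can be drawn from
   one. *)
have PF : ProperFilter (almost_everywhere P).
  by apply: ae_properfilter_algebraOfSetsType; rewrite -[ltRHS]/(P setT) probability_setT lte01.
have [w /= /(_ I) [fw0]] := filter_ex ae0.
by have := f0 w; rewrite fw0 ltxx.
Qed.

End probability_Rintegral.

(** * Bounds on the Laplace transform of a positive variable *)

Section laplace1.
Context d (T : measurableType d) (R : realType) (P : probability T R).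
Implicit Type tau : {RV P >-> R}.

Lemma laplace1E tau : laplace1 tau = (\int[P]_w expR (- tau w))%R.
Proof. by rewrite /laplace1 unlock. Qed.

Lemma measurable_expRN (f : T -> R) : measurable_fun setT f ->
  measurable_fun setT (fun w : T => expR (- f w)).
Proof.
by move=> mf; apply: measurableT_comp => //; exact: measurableT_comp.
Qed.

(** Both [expR (- tau)] and [1 - expR (- tau)] are positive everywhere, so both have positive
    integrals. *)
Lemma laplace1_gt0_lt1 tau : positive_rv tau -> 0 < laplace1 tau < 1.
Proof.
move=> tau0; rewrite laplace1E.
have mL : measurable_fun setT (fun w => expR (- tau w)) by exact: measurable_expRN.
have IL : P.-integrable setT (EFin \o (fun w => expR (- tau w))).
  by apply: (bounded_integrable_probability P mL) => w; exact: normr_expRN_le1.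
apply/andP; split; first by apply: Rintegral_gt0 => // w; exact: expR_gt0.
have I1 : P.-integrable setT (EFin \o cst (1 : R)).
  by apply: (@bounded_integrable_probability _ _ _ P _ 1) => // w; rewrite normr1.
have : 0 < (\int[P]_w (cst 1 w - expR (- tau w)))%R.
  apply: Rintegral_gt0.
  - exact: measurable_funB.
  - apply: (@bounded_integrable_probability _ _ _ P _ 1); first exact: measurable_funB.
    move=> w; rewrite /= ger0_norm ?lerBlDr ?lerDl ?expR_ge0//.
    by rewrite subr_ge0 expR_le1 oppr_le0 ltW.
  - by move=> w; rewrite subr_gt0 expR_lt1 oppr_lt0.
by rewrite RintegralB// Rintegral_cst_probability subr_gt0.
Qed.

End laplace1.

(** * The scalar equation in t and its correspondence with the fixed points *)

Section scaled_laplace.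
Context d (T : measurableType d) (R : realType) (P : probability T R).
Variables lambda beta : {RV P >-> R}.
Hypotheses (lambda_pos : positive_rv lambda) (beta_pos : positive_rv beta).

(** This is [lambda] times x to the power [- beta], for x = exp t; the parameter then ranges over
    the whole line. *)
Definition scaled (t : R) (w : T) : R := lambda w * expR (- (t * beta w)).

Lemma scaled_gt0 t w : 0 < scaled t w.
Proof. by rewrite mulr_gt0 ?expR_gt0. Qed.

Lemma measurable_scaled t : measurable_fun setT (scaled t).
Proof.
apply: measurable_funM => //; apply: measurable_expRN.
exact: measurable_funM.
Qed.

Definition scaled_laplace t : R := (\int[P]_w expR (- scaled t w))%R.

Let norm1 t w : `|expR (- scaled t w)| <= 1.
Proof. exact/normr_expRN_le1/scaled_gt0. Qed.

Lemma scaled_laplace_homo : {homo scaled_laplace : s t / s <= t}.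
Proof.
move=> s t st; apply: le_Rintegral => //.
1,2: apply: (bounded_integrable_probability P _ (norm1 _));
  exact/measurable_expRN/measurable_scaled.
by move=> w _; rewrite ler_expR lerN2 ler_pM2l// ler_expR lerN2 ler_pM2r.
Qed.

(** Reduces continuity and both limits at infinity to pointwise convergence, the integrands being
    dominated by the constant 1. *)
Lemma scaled_laplace_cvg (u : nat -> R) (f : T -> R) : measurable_fun setT f ->
  (forall w, `|f w| <= 1) ->
  (forall w, expR (- scaled (u n) w) @[n --> \oo] --> f w) ->
  scaled_laplace (u n) @[n --> \oo] --> (\int[P]_w f w)%R.
Proof.
move=> mf f1 uf; apply: bounded_cvg_Rintegral => //.
by move=> n; exact/measurable_expRN/measurable_scaled.
Qed.

Lemma continuous_scaled_laplace : continuous scaled_laplace.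
Proof.
move=> t; apply/(@cvg_nbhsP _ R^o) => u ut.
apply: scaled_laplace_cvg => //; first exact/measurable_expRN/measurable_scaled.
move=> w; apply: continuous_cvg; first exact: continuous_expR.
apply: cvgN; apply: cvgMr; apply: continuous_cvg; first exact: continuous_expR.
by apply: cvgN; exact: cvgMl.
Qed.

Lemma scaled_laplace_cvgy : scaled_laplace n%:R @[n --> \oo] --> (1 : R).
Proof.
rewrite -[X in _ --> X](Rintegral_cst_probability P).
apply: scaled_laplace_cvg => //= w; first by rewrite normr1.
rewrite -[X in _ --> X]expR0; apply: continuous_cvg; first exact: continuous_expR.
rewrite -[X in _ --> X]oppr0 -[X in _ --> - X](mulr0 (lambda w)).
apply: cvgN; apply: cvgMr.
apply: (@cvg_comp _ _ _ (fun n => n%:R * beta w) (fun x : R => expR (- x))).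
  exact: cvgn_mulry.
exact: cvgr_expR.
Qed.

Lemma scaled_laplace_cvgNy : scaled_laplace (- n%:R) @[n --> \oo] --> (0 : R).
Proof.
rewrite -[X in _ --> X](Rintegral_cst_probability P).
apply: scaled_laplace_cvg => //= w; first by rewrite normr0.
apply: (@cvg_comp _ _ _ (fun n => scaled (- n%:R) w) (fun x : R => expR (- x)));
  last exact: cvgr_expR.
(* By [1 + y <= expR y] at [y = n%:R * beta w], the scaled value is at least a fixed positive
   multiple of n. *)
apply: (@ger_cvgy _ _ _ _ (fun n => n%:R * (beta w * lambda w))).
  apply: nearW => n; rewrite /scaled mulNr opprK mulrA mulrC ler_pM2l//.
  by apply: le_trans (expR_ge1Dx _); rewrite lerDr.
by apply: cvgn_mulry; rewrite mulr_gt0.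
Qed.

Lemma scaled_laplace_crossing : exists t, scaled_laplace t = (1 + expR t)^-1.
Proof.
pose h t := scaled_laplace t - (1 + expR t)^-1.
have pos1 t : 0 < 1 + expR t :> R by rewrite addr_gt0 ?expR_gt0.
have ch : continuous h.
  move=> t; apply: cvgB; first exact: continuous_scaled_laplace.
  apply: cvgV; first by rewrite gt_eqF.
  by apply: cvgD; [exact: cvg_cst|exact: continuous_expR].
(* One half is the value of [(1 + expR t)^-1] at t = 0: that decreasing side is at least 1/2 on the
   left of 0 and at most 1/2 on the right, so comparing [scaled_laplace] with 1/2 gives the signs of
   [h]. *)
have half : (2^-1 : R) < 1 by rewrite invf_lt1// ltr1n.
have half0 : 0 < (2^-1 : R) by rewrite invr_gt0.
have [n /ltW Gn] := filter_ex (cvgr_lt _ scaled_laplace_cvgNy _ half0).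
have [m /ltW Gm] := filter_ex (cvgr_gt _ scaled_laplace_cvgy _ half).
have hn : h (- n%:R) <= 0.
  rewrite subr_le0 (le_trans Gn)// lef_pV2 ?posrE//.
  by rewrite (_ : 2 = 1 + 1)// lerD2l expR_le1 oppr_le0.
have hm : 0 <= h m%:R.
  rewrite subr_ge0 (le_trans _ Gm)// lef_pV2 ?posrE//.
  by rewrite (_ : 2 = 1 + 1)// lerD2l -expR0 ler_expR.
have nm : - n%:R <= m%:R :> R by rewrite (@le_trans _ _ 0)// oppr_le0.
have [|t _ /eqP] := @IVT R h _ _ 0 nm (continuous_subspaceT ch).
  by rewrite ge_min hn/= le_max hm orbT.
by rewrite subr_eq0 => /eqP; exists t.
Qed.

Lemma scaled_laplace_crossing_unique s t :
  scaled_laplace s = (1 + expR s)^-1 -> scaled_laplace t = (1 + expR t)^-1 -> s = t.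
Proof.
wlog st : s t / s <= t => [wl Gs Gt|Gs Gt].
  by have [/wl|/ltW/wl] := leP s t; [exact|move=> /(_ Gt Gs)].
(* Strict decrease of the right-hand side turns the goal [t <= s] into
   [scaled_laplace s <= scaled_laplace t]. *)
apply/eqP; rewrite eq_le st/= -ler_expR -(lerD2l 1) -lef_pV2 ?posrE ?addr_gt0 ?expR_gt0//.
by rewrite -Gs -Gt scaled_laplace_homo.
Qed.

Definition scaledRV t : {RV P >-> R} :=
  HB.pack (scaled t) (isMeasurableFun.Build _ _ _ _ _ (measurable_scaled t)).

(** At a crossing, [1 / laplace1 - 1] equals [expR t], whose power [beta] cancels the factor
    [expR (- (t * beta))]. *)
Lemma solves_fixed_point_scaled t :
  scaled_laplace t = (1 + expR t)^-1 -> solves_fixed_point lambda beta (scaledRV t).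
Proof.
move=> Gt; apply: aeW => w.
have -> : laplace1 (scaledRV t) = (1 + expR t)^-1 by rewrite laplace1E.
by rewrite div1r invrK addrC addKr -expRM /= /scaled -mulrA -expRD addNr expR0 mulr1.
Qed.

Lemma solves_fixed_point_crossing (tau : {RV P >-> R}) :
  positive_rv tau -> solves_fixed_point lambda beta tau ->
  exists2 t, scaled_laplace t = (1 + expR t)^-1 & {ae P, forall w, tau w = scaled t w}.
Proof.
move=> tau0 tauE; have /andP[L0 L1] := laplace1_gt0_lt1 tau0.
have x0 : 0 < 1 / laplace1 tau - 1 by rewrite subr_gt0 div1r invf_gt1.
(* The logarithm is legitimate because the Laplace transform lies strictly between 0 and 1; solving
   the equation for [tau] then gives [scaled t] almost surely. *)
pose t := ln (1 / laplace1 tau - 1).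
have xE : 1 / laplace1 tau - 1 = expR t by rewrite lnK ?posrE.
have ae_tau : {ae P, forall w, tau w = scaled t w}.
  apply: filterS tauE => w; rewrite xE -expRM /scaled => ->.
  by rewrite -mulrA -expRD subrr expR0 mulr1.
exists t => //; rewrite -xE addrC subrK div1r invrK laplace1E.
(* Almost surely equal variables have the same Laplace transform, so [t] is a crossing. *)
congr fine; apply: ae_eq_integral => //.
- exact/measurable_EFinP/measurable_expRN/measurable_scaled.
- exact/measurable_EFinP/measurable_expRN.
- by apply: filterS ae_tau => w + _ => ->.
Qed.

End scaled_laplace.

Theorem theorem4p5 (d : measure_display) (T : measurableType d) (R : realType)
    (P : probability T R) (lambda beta : {RV P >-> R})
    (lambda_pos : positive_rv lambda) (beta_pos : positive_rv beta)
    (moment1 : ('E_P[fun w => (beta w / (lambda w `^ (1 / beta w))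
        * ((beta w + 1) / beta w) `^ ((beta w + 1) / beta w))%R] < +oo)%E)
    (moment2 : ('E_P[lambda] < +oo)%E)
    (moment3 : ('E_P[fun w => (lambda w * beta w)%R] < +oo)%E) :
  exists tau : {RV P >-> R},
    [/\ positive_rv tau,
        solves_fixed_point lambda beta tau &
        forall tau' : {RV P >-> R},
          positive_rv tau' -> solves_fixed_point lambda beta tau' ->
          {ae P, forall w, tau' w = tau w}].
Proof.
have [t Gt] := scaled_laplace_crossing lambda_pos beta_pos.
exists (scaledRV lambda beta t); split.
- by move=> w; exact: scaled_gt0.
- exact: solves_fixed_point_scaled.
(* Any other solution is almost surely [scaled s] for a crossing [s], and there is only one
   crossing. *)
- move=> tau' tau'0 /(solves_fixed_point_crossing tau'0)[s Gs].
  by rewrite (scaled_laplace_crossing_unique lambda_pos beta_pos Gs Gt).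
Qed.
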